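(* For all real numbers $a,b >0$ and every integer $m \geq 2$, $$L(a,b) \le \frac{1}{m} \left\{ \sum_{k=0}^m a^{k/m} b^{(m-k)/m} - \frac{a+b}{2} \right\} \le \frac{1}{m} \sum_{k=0}^{m-1}a^{k/(m-1)}b^{(m-1-k)/(m-1)} \leq \frac{a+b}{2}.$$
   Context: For positive real numbers $a,b$, $L(a,b)$ denotes the logarithmic mean: $L(a,b) = \frac{a-b}{\log a-\log b} = \int_0^1 a^{\nu} b^{1-\nu}\, d\nu$ if $a\neq b$, and $L(a,b)=a$ if $a=b$. *)

(* Defs.v *)
From Stdlib Require Import Reals.
Open Scope R_scope.

(* Only meaningful for positive [a] and [b]. *)
Definition log_mean (a b : R) : R :=
  if Req_EM_T a b then a else (a - b) / (ln a - ln b).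

(* Main.v *)
(* With f(t) = a^t b^(1-t) = exp (t ln a + (1-t) ln b), a convex function, the four terms are the
   integral of f over [0,1], its trapezoidal sum with m steps, the average of f over m equally
   spaced nodes including both endpoints, and the average of the endpoint values.
   The logarithmic mean of two values of exp is at most their arithmetic mean; applied to
   consecutive nodes k/m and summed, the left-hand sides telescope to the first inequality.
   The third inequality bounds f by its chord on [0,1].
   For the second, k/m is the combination of (k-1)/(m-1) and k/(m-1) with weights k/m and 1 - k/m;
   summing the convexity inequalities gives
   sum_(k<=m) f(k/m) <= (1 + 1/m) sum_(j<m) f(j/(m-1)), and the extra 1/m part is absorbed
   by (a+b)/2 thanks to the third inequality. *)
Require Import Defs.
From Stdlib Require Import Reals Lra Lia.
From Coquelicot Require Import Coquelicot.
Open Scope R_scope.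

Lemma exp_convex (x y t : R) :
  0 <= t <= 1 -> exp (t * x + (1 - t) * y) <= t * exp x + (1 - t) * exp y.
Proof.
  intros Ht.
  set (z := t * x + (1 - t) * y).
  (* The graph of exp lies above its tangent line at z. *)
  assert (tangent : forall w, exp z * (1 + (w - z)) <= exp w).
  { intros w.
    replace (exp w) with (exp z * exp (w - z)) by (rewrite <- exp_plus; f_equal; ring).
    apply Rmult_le_compat_l; [left; apply exp_pos | apply exp_ineq1_le]. }
  pose proof (Rmult_le_compat_l t _ _ (proj1 Ht) (tangent x)).
  pose proof (Rmult_le_compat_l (1 - t) _ _ ltac:(lra) (tangent y)).
  replace (exp z) with
    (t * (exp z * (1 + (x - z))) + (1 - t) * (exp z * (1 + (y - z))))
    by (unfold z; ring).
  lra.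
Qed.

(** The function [g] vanishes at 0 and is nondecreasing, so [g u * u] is nonnegative for either sign
    of [u]. *)
Lemma exp_slope_le_mean (u : R) : (exp u - 1) * u <= (exp u + 1) / 2 * u ^ 2.
Proof.
  set (g := fun v => v * (exp v + 1) - 2 * (exp v - 1)).
  set (dg := fun v => v * exp v + 1 - exp v).
  assert (dg_ge0 : forall v, 0 <= dg v).
  { intros v.
    (* Nonnegativity of [dg v] is the tangent bound at [- v], multiplied by [exp v]. *)
    assert (H : exp v * (1 + - v) <= exp v * exp (- v))
      by (apply Rmult_le_compat_l; [left; apply exp_pos | apply exp_ineq1_le]).
    rewrite <- exp_plus, Rplus_opp_r, exp_0 in H.
    unfold dg; lra. }
  destruct (MVT_gen g 0 u dg) as [c [_ Hc]].
  - intros v _; unfold g, dg; auto_derive; [exact I | ring].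
  - intros v _; apply derivable_continuous_pt.
    exists (dg v); apply is_derive_Reals; unfold g, dg; auto_derive; [exact I | ring].
  - assert (g0 : g 0 = 0) by (unfold g; rewrite exp_0; ring).
    assert (Hg : g u * u = dg c * u ^ 2) by (rewrite g0 in Hc; simpl; nra).
    pose proof (Rmult_le_pos _ _ (dg_ge0 c) (pow2_ge_0 u)).
    unfold g in Hg; simpl in *; nra.
Qed.

(** Factoring out [exp y] leaves the case u = x - y. The factor (x - y)^2 clears the denominator of
    the logarithmic mean, so neither x <> y nor an order is assumed. *)
Lemma exp_diff_le_mean (x y : R) :
  (exp x - exp y) * (x - y) <= (exp x + exp y) / 2 * (x - y) ^ 2.
Proof.
  replace (exp x) with (exp y * exp (x - y)) by (rewrite <- exp_plus; f_equal; ring).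
  pose proof (Rmult_le_compat_l (exp y) _ _ (Rlt_le _ _ (exp_pos y)) (exp_slope_le_mean (x - y))).
  nra.
Qed.

Lemma trapezoid_sum_le (F : nat -> R) (c d : R) (n : nat) :
  (forall k, (F (S k) - F k) * c <= (F (S k) + F k) / 2 * d) ->
  (F (S n) - F 0%nat) * c <= (sum_f_R0 F (S n) - (F 0%nat + F (S n)) / 2) * d.
Proof.
  intros step; induction n as [|n IH].
  - specialize (step 0%nat); simpl; lra.
  - specialize (step (S n)).
    rewrite tech5; lra.
Qed.

(** For j <= n, [G j] collects j + 1 from k = j + 1 and M - j from k = j. The leftover last term
    vanishes when M = n + 1. *)
Lemma sum_neighbour_weights (G : nat -> R) (M : R) (n : nat) :
  sum_f_R0 (fun k => INR k * G (pred k) + (M - INR k) * G k) (S n) =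
  (M + 1) * sum_f_R0 G n + (M - INR (S n)) * G (S n).
Proof.
  induction n as [|n IH].
  - simpl; ring.
  - rewrite tech5, IH, (tech5 G n), !S_INR; simpl pred; ring.
Qed.

(** Sums the chord over the nodes k/c; [c] is separate from [n] so that it stays fixed in the
    induction. *)
Lemma sum_affine (a b c : R) (n : nat) :
  sum_f_R0 (fun k => INR k / c * a + (1 - INR k / c) * b) n =
  INR (S n) * (b + INR n / c / 2 * (a - b)).
Proof.
  induction n as [|n IH].
  - simpl; unfold Rdiv; ring.
  - rewrite tech5, IH, !S_INR; unfold Rdiv; generalize (/ c); intros d; field.
Qed.

Definition geodesic (a b t : R) : R := exp (t * ln a + (1 - t) * ln b).

Lemma geodesic_0 (a b : R) : 0 < b -> geodesic a b 0 = b.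
Proof.
  intros hb; unfold geodesic.
  rewrite <- (exp_ln b hb) at 2; f_equal; ring.
Qed.

Lemma geodesic_1 (a b : R) : 0 < a -> geodesic a b 1 = a.
Proof.
  intros ha; unfold geodesic.
  rewrite <- (exp_ln a ha) at 2; f_equal; ring.
Qed.

Lemma geodesic_convex (a b s t l : R) : 0 <= l <= 1 ->
  geodesic a b (l * s + (1 - l) * t) <= l * geodesic a b s + (1 - l) * geodesic a b t.
Proof.
  intros hl; unfold geodesic.
  eapply Rle_trans; [right | apply (exp_convex _ _ l hl)].
  f_equal; ring.
Qed.

Lemma geodesic_le_chord (a b t : R) : 0 < a -> 0 < b -> 0 <= t <= 1 ->
  geodesic a b t <= t * a + (1 - t) * b.
Proof.
  intros ha hb ht.
  pose proof (geodesic_convex a b 1 0 t ht) as H.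
  rewrite geodesic_0, geodesic_1 in H by assumption.
  replace (t * 1 + (1 - t) * 0) with t in H by ring.
  exact H.
Qed.

Lemma INR_ratio_bounds (k n : nat) : (0 < n)%nat -> (k <= n)%nat -> 0 <= INR k / INR n <= 1.
Proof.
  intros hn hk; apply lt_0_INR in hn; apply le_INR in hk; pose proof (pos_INR k).
  split.
  - now apply Rdiv_le_0_compat.
  - apply Rle_div_l; lra.
Qed.

Lemma sum_Rpower_geodesic (a b : R) (n : nat) : (0 < n)%nat ->
  sum_f_R0 (fun k => Rpower a (INR k / INR n) * Rpower b (INR (n - k) / INR n)) n =
  sum_f_R0 (fun k => geodesic a b (INR k / INR n)) n.
Proof.
  intros hn; apply sum_eq; intros k hk.
  unfold Rpower, geodesic; rewrite <- exp_plus, minus_INR by exact hk.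
  apply lt_0_INR in hn; f_equal; field; lra.
Qed.

Lemma log_mean_le_trapezoid (a b : R) (n : nat) : 0 < a -> 0 < b ->
  log_mean a b <=
  1 / INR (S n) *
    (sum_f_R0 (fun k => geodesic a b (INR k / INR (S n))) (S n) - (a + b) / 2).
Proof.
  intros ha hb.
  assert (hM : 0 < INR (S n)) by (apply lt_0_INR; lia).
  set (M := INR (S n)) in *.
  set (F := fun k : nat => geodesic a b (INR k / M)).
  set (D := ln a - ln b).
  assert (F0 : F 0%nat = b)
    by (unfold F; simpl; unfold Rdiv; rewrite Rmult_0_l; now apply geodesic_0).
  assert (F1 : F (S n) = a)
    by (unfold F; fold M; unfold Rdiv; rewrite Rinv_r by lra; now apply geodesic_1).
  assert (H := trapezoid_sum_le F (D / M) ((D / M) ^ 2) n).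
  rewrite F0, F1 in H.
  set (T := sum_f_R0 F (S n) - (a + b) / 2).
  replace (sum_f_R0 F (S n) - (b + a) / 2) with T in H by (unfold T; lra).
  assert (HT : (a - b) * (D / M) <= T * (D / M) ^ 2).
  { apply H; intros k; unfold F, geodesic.
    (* [D / M] is the constant increment between consecutive exponents. *)
    replace (D / M) with
      (INR (S k) / M * ln a + (1 - INR (S k) / M) * ln b
       - (INR k / M * ln a + (1 - INR k / M) * ln b))
      by (rewrite (S_INR k); unfold D; field; lra).
    apply exp_diff_le_mean. }
  unfold log_mean; destruct (Req_EM_T a b) as [<- | hab].
  - (* For a = b the function is constant and the claim is an equality. *)
    assert (HS : sum_f_R0 F (S n) = a * (M + 1)).
    { rewrite (sum_eq F (fun _ => a)).
      - rewrite sum_cte, (S_INR (S n)); fold M; ring.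
      - intros k _; unfold F, geodesic.
        rewrite <- (exp_ln a ha) at 3; f_equal; ring. }
    right; unfold T; rewrite HS; field; lra.
  - assert (hD : D <> 0)
      by (unfold D; intros E; apply hab, ln_inv; [assumption | assumption | lra]).
    fold D.
    assert (hD2 : 0 < (D / M) ^ 2) by (apply pow2_gt_0, Rmult_integral_contrapositive_currified;
      [exact hD | apply Rinv_neq_0_compat; lra]).
    (* The square makes this multiplier positive whatever the sign of [D]. *)
    apply (Rmult_le_reg_r (M * (D / M) ^ 2)); [now apply Rmult_lt_0_compat|].
    replace ((a - b) / D * (M * (D / M) ^ 2)) with ((a - b) * (D / M)) by (field; lra).
    replace (1 / M * T * (M * (D / M) ^ 2)) with (T * (D / M) ^ 2) by (field; lra).
    exact HT.
Qed.

Lemma node_average_le_mean (a b : R) (n : nat) : 0 < a -> 0 < b -> (0 < n)%nat ->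
  1 / INR (S n) * sum_f_R0 (fun k => geodesic a b (INR k / INR n)) n <= (a + b) / 2.
Proof.
  intros ha hb hn.
  assert (hN : 0 < INR n) by (now apply lt_0_INR).
  assert (hM : 0 < INR (S n)) by (apply lt_0_INR; lia).
  (* The mean is rewritten as the average of the chord over the nodes k/n. *)
  replace ((a + b) / 2) with
    (1 / INR (S n) * (INR (S n) * (b + INR n / INR n / 2 * (a - b)))) by (field; lra).
  apply Rmult_le_compat_l; [apply Rlt_le, Rdiv_lt_0_compat; lra|].
  rewrite <- sum_affine.
  apply sum_Rle; intros k hk.
  apply geodesic_le_chord; auto using INR_ratio_bounds.
Qed.

Lemma node_sum_succ_le (a b : R) (n : nat) : (0 < n)%nat ->
  sum_f_R0 (fun k => geodesic a b (INR k / INR (S n))) (S n) <=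
  (1 + 1 / INR (S n)) * sum_f_R0 (fun k => geodesic a b (INR k / INR n)) n.
Proof.
  intros hn.
  assert (hN : 0 < INR n) by (now apply lt_0_INR).
  assert (hM : 0 < INR (S n)) by (apply lt_0_INR; lia).
  set (G := fun k : nat => geodesic a b (INR k / INR n)).
  assert (E := sum_neighbour_weights G (INR (S n)) n).
  apply (Rmult_le_reg_l (INR (S n))); [exact hM|].
  replace (INR (S n) * ((1 + 1 / INR (S n)) * sum_f_R0 G n)) with
    ((INR (S n) + 1) * sum_f_R0 G n + (INR (S n) - INR (S n)) * G (S n)) by (field; lra).
  rewrite <- E, scal_sum.
  apply sum_Rle; intros k hk.
  destruct k as [|k].
  - unfold G; simpl (INR 0); unfold Rdiv; rewrite !Rmult_0_l; lra.
  - assert (hl := INR_ratio_bounds (S k) (S n) ltac:(lia) hk).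
    (* When k = n the second node exceeds 1, but its weight is 0. *)
    pose proof (geodesic_convex a b (INR k / INR n) (INR (S k) / INR n) _ hl) as H.
    replace (INR (S k) / INR (S n) * (INR k / INR n)
             + (1 - INR (S k) / INR (S n)) * (INR (S k) / INR n))
      with (INR (S k) / INR (S n)) in H
      by (rewrite (S_INR k), (S_INR n) in *; field; lra).
    apply (Rmult_le_compat_r (INR (S n))) in H; [|lra].
    eapply Rle_trans; [exact H | right].
    unfold G; simpl pred; field; lra.
Qed.

(* [sum_f_R0 f n] is f 0 + ... + f n, with both endpoints included. *)
Theorem lemma3p4 (a b : R) (m : nat) (ha : 0 < a) (hb : 0 < b) (hm : (2 <= m)%nat) :
  log_mean a b <=
    1 / INR m *
      (sum_f_R0 (fun k : nat =>
         Rpower a (INR k / INR m) * Rpower b (INR (m - k) / INR m)) m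
       - (a + b) / 2)
  /\
  1 / INR m *
      (sum_f_R0 (fun k : nat =>
         Rpower a (INR k / INR m) * Rpower b (INR (m - k) / INR m)) m
       - (a + b) / 2)
  <=
    1 / INR m *
      sum_f_R0 (fun k : nat =>
        Rpower a (INR k / INR (m - 1)) *
        Rpower b (INR (m - 1 - k) / INR (m - 1))) (m - 1)
  /\
  1 / INR m *
      sum_f_R0 (fun k : nat =>
        Rpower a (INR k / INR (m - 1)) *
        Rpower b (INR (m - 1 - k) / INR (m - 1))) (m - 1)
  <= (a + b) / 2.
Proof.
  destruct m as [|n]; [lia|].
  assert (hn : (0 < n)%nat) by lia.
  replace (S n - 1)%nat with n by lia.
  rewrite !sum_Rpower_geodesic by lia.
  pose proof (node_average_le_mean a b n ha hb hn) as average.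
  split; [now apply log_mean_le_trapezoid | split; [|exact average]].
  assert (hM : 0 < INR (S n)) by (apply lt_0_INR; lia).
  apply Rmult_le_compat_l; [apply Rlt_le, Rdiv_lt_0_compat; lra|].
  pose proof (node_sum_succ_le a b n hn).
  lra.
Qed.
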